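(* Let $X$ be an infinite set and let $I\subseteq \mathscr{P}(X)$ be a maximal ideal on $X$. Let $$\mathscr{C}_I=\bigcup_{n=1}^\infty\{f\in\mathscr{O}^{(n)} : \forall A\in I\ \ f[A^n]\in I\}.$$ Then: (1) $\mathscr{C}_I\subsetneq\mathscr{O}$. (2) $\mathscr{C}_I$ is a clone. (3) If $f:X^k\to X$ and $\operatorname{ran}(f)\in I$, then $f\in\mathscr{C}_I$. More generally, if $A\in I$, $f:X^k\to X^n$ and the range of $f$ is contained in $A^n$, then $f\in\tilde{\mathscr{C}}_I$. (4) $I$ can be reconstructed from $\mathscr{C}_I$ as $$I=\{A\subseteq X : \text{for all } f:X\to X,\ \text{if } \operatorname{ran}(f)\subseteq A \text{ then } f\in\mathscr{C}_I\};$$ in particular the map $I\mapsto\mathscr{C}_I$ (on maximal ideals) is one-to-one. (5) $\mathscr{C}_I$ is a precomplete clone, i.e., for every $f\in\mathscr{O}\setminus\mathscr{C}_I$ the clone generated by $\mathscr{C}_I\cup\{f\}$ is all of $\mathscr{O}$.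
   Context: For a set $X$, $\mathscr{O}^{(n)}$ is the set of all functions $X^n\to X$ ($n\ge1$) and $\mathscr{O}=\bigcup_{n\ge1}\mathscr{O}^{(n)}$. A clone on $X$ is a set $\mathscr{C}\subseteq\mathscr{O}$ that contains all projections $\pi^n_k(x_1,\dots,x_n)=x_k$ ($1\le k\le n$) and is closed under composition: if $f_1,\dots,f_k\in\mathscr{C}\cap\mathscr{O}^{(n)}$ and $g\in\mathscr{C}\cap\mathscr{O}^{(k)}$, then $(x_1,\dots,x_n)\mapsto g(f_1(x_1,\dots,x_n),\dots,f_k(x_1,\dots,x_n))$ is in $\mathscr{C}$. A precomplete (= maximal) clone is a coatom of the lattice of clones on $X$, whose largest element is $\mathscr{O}$. For a clone $\mathscr{C}$, $\tilde{\mathscr{C}}$ denotes the set of all functions $\bar f:X^n\to X^k$ ($n,k>0$) such that each $\pi^k_i\circ\bar f$ ($1\le i\le k$) is in $\mathscr{C}$. An ideal on $X$ is a proper ideal of the Boolean algebra $\mathscr{P}(X)$ (the power set of $X$); it is maximal if it is maximal among proper ideals, i.e. its dual filter is an ultrafilter. *)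

(* Defs.v *)
From mathcomp Require Import all_boot all_classical.

Set Implicit Arguments.
Unset Strict Implicit.
Unset Printing Implicit Defensive.

Local Open Scope classical_set_scope.

(* X^n is n.-tuple X.  Clones have no nullary operations, so the arity of an
   operation is the successor of its field arity_pred; the type (op X) is the
   (disjoint) union of the O^(n), n >= 1, and [set: op X] is the full clone. *)
Record op (X : Type) : Type := Op {
  arity_pred : nat ;
  op_fun :> arity_pred.+1.-tuple X -> X }.

Arguments Op {X arity_pred} op_fun.
Arguments op_fun {X} _ _.

Definition unop (X : Type) (f : X -> X) : op X :=
  Op (fun x : 1.-tuple X => f (tnth x ord0)).

Definition cartesian_power (X : Type) (n : nat) (A : set X) :
  set (n.-tuple X) := [set x | forall i : 'I_n, A (tnth x i)].

Arguments cartesian_power {X} n A.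

Record is_clone (X : Type) (C : set (op X)) : Prop := IsClone {
  clone_proj : forall (n : nat) (k : 'I_n.+1),
    C (Op (fun x : n.+1.-tuple X => tnth x k)) ;
  clone_comp : forall (n k : nat) (g : k.+1.-tuple X -> X)
      (f : 'I_k.+1 -> n.+1.-tuple X -> X),
    C (Op g) -> (forall i, C (Op (f i))) ->
    C (Op (fun x : n.+1.-tuple X => g [tuple f i x | i < k.+1])) }.

Definition clone_generated (X : Type) (F : set (op X)) : set (op X) :=
  smallest (@is_clone X) F.

(* Coatom of the lattice of clones ordered by inclusion. *)
Definition precomplete (X : Type) (C : set (op X)) : Prop :=
  [/\ is_clone C, C `<` [set: op X] &
      forall D : set (op X), is_clone D -> C `<` D -> D = [set: op X]].

(* C~, restricted to the functions X^(n+1) -> X^(k+1). *)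
Definition clone_tilde (X : Type) (C : set (op X)) (n k : nat) :
    set (n.+1.-tuple X -> k.+1.-tuple X) :=
  [set f | forall i : 'I_k.+1, C (Op (fun x => tnth (f x) i))].

Arguments clone_tilde {X} C n k.

Record is_ideal (X : Type) (I : set (set X)) : Prop := IsIdeal {
  ideal0 : I set0 ;
  idealS : forall A B : set X, A `<=` B -> I B -> I A ;
  idealU : forall A B : set X, I A -> I B -> I (A `|` B) ;
  ideal_proper : ~ I [set: X] }.

Definition maximal_ideal (X : Type) (I : set (set X)) : Prop :=
  is_ideal I /\
  forall J : set (set X), is_ideal J -> I `<=` J -> J = I.

Definition ideal_clone (X : Type) (I : set (set X)) : set (op X) :=
  [set f : op X | forall A : set X,
     I A -> I (op_fun f @` cartesian_power (arity_pred f).+1 A)].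

(* Main.v *)
Require Import Defs.
From mathcomp Require Import all_boot all_classical.

Local Open Scope classical_set_scope.

(** Two families of operations always preserve an ideal: those whose range lies
in a member of the ideal ([ideal_clone_range]) and those that always return one
of their arguments ([ideal_clone_conservative]).

Precompleteness ([ideal_clone_coatom]).  Let f lie outside the clone of I, so
that B = f[A^n] is not in I for some A in I.  An operation u with values in B
is f o g for some g with values in A^n, and the components of g preserve I by
the range criterion; so u is generated.  As I is maximal, the complement of B
is in I, so an operation with values off B preserves I.  An arbitrary u is glued
from these two kinds by a conservative ternary if-then-else, whose third
argument is a two-valued test taking its values p <> q in a pair {p, q} of I.

Properness and reconstruction.  Both need one unary f and one B in I such that
f[B] is not in I ([maximal_ideal_escape]).  If there were none, membership in I
would be invariant under bijections between subsets of X.  A maximal matching on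
X, given by Zorn's lemma, splits X into two halves in bijection and at most one
more point.  One half is in I because I is prime, hence so is the other, and
then X itself.  If now A is not in I, composing the escaping f with a
retraction of X onto A gives an operation with range in A that still escapes,
again because I is prime.  So I is read off from its clone
([ideal_clone_reconstruct]); since the whole of X is not in I, some unary
operation is missing from the clone. *)

Lemma maximal_idealC {X : Type} {I : set (set X)} (hI : maximal_ideal I)
  (A : set X) : ~ I A -> I (~` A).
Proof.
case: hI => -[I0 IS IU IT] Imax nIA; apply: contrapT => nIcA.
(* The ideal generated by I and A; were it proper, A would be in I. *)
pose J := [set B : set X | exists2 C, I C & B `<=` A `|` C].
have idJ : is_ideal J.
  split.
  - by exists set0 => //; exact: sub0set.
  - by move=> B B' BB' [C IC B'C]; exists C => //; exact: subset_trans B'C.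
  - move=> B B' [C IC BC] [C' IC' B'C']; exists (C `|` C'); first exact: IU.
    move=> x [/BC|/B'C'] [?|?]; by [left|right; left|right; right].
  - move=> [C IC TC]; apply: nIcA; apply: IS IC => x nAx.
    by case: (TC x Logic.I).
have JI : J = I.
  by apply: Imax => // B IB; exists B => // x Bx; right.
by apply: nIA; rewrite -JI; exists set0 => // x; left.
Qed.

Lemma maximal_ideal_prime {X : Type} {I : set (set X)} (hI : maximal_ideal I)
  (A B : set X) : I (A `&` B) -> I A \/ I B.
Proof.
move=> IAB; have [?|nIA] := pselect (I A); first by left.
right; have IcA := maximal_idealC hI _ nIA.
have [[_ IS IU _] _] := hI; apply: IS (IU _ _ IAB IcA) => x Bx.
by have [?|?] := pselect (A x); [left|right].
Qed.

Lemma ideal_notin_nonempty {X : Type} {I : set (set X)} (hI : is_ideal I)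
  (A : set X) : ~ I A -> exists a, A a.
Proof.
move=> nIA; apply: contrapT => nA; apply: nIA.
by apply: (idealS hI) (ideal0 hI) => x Ax; case: nA; exists x.
Qed.

Lemma infinite_setT_injection (X : Type) :
  infinite_set [set: X] -> exists e : nat -> X, injective e.
Proof.
elim/Ppointed: X => X.
  by rewrite emptyE => /(_ (finite_set0 _)).
by move=> /infiniteP/pcard_injP[e eI]; exists e => m n; apply: eI; rewrite inE.
Qed.

(** Given two disjoint pairs, the second lies in the complement of the first, and
that complement is in I when the first pair is not.  This covers principal and nonprincipal ideals
at once. *)
Lemma maximal_ideal_pair {X : Type} (hX : infinite_set [set: X])
  {I : set (set X)} (hI : maximal_ideal I) :
  exists p q : X, p <> q /\ I [set p; q].
Proof.
have [e e_inj] := infinite_setT_injection _ hX.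
have eI m n : m <> n -> e m <> e n by move=> mn /e_inj.
have [I01|/(maximal_idealC hI) Ic] := pselect (I [set e 0; e 1]).
  by exists (e 0), (e 1); split => //; exact: eI.
exists (e 2), (e 3); split; first exact: eI.
by apply: (idealS hI.1) Ic => x [->|->] [] /eI; apply.
Qed.

(** A pair of R is an oriented edge.  Quantifying over two edges at a time keeps
the property stable under unions of chains; the case p = q of the last clause
forbids loops. *)
Definition matching {X : Type} (R : set (X * X)) : Prop :=
  forall p q, R p -> R q ->
    [/\ p.1 = q.1 -> p = q, p.2 = q.2 -> p = q & p.1 <> q.2].

(** By Zorn's lemma there is a maximal matching; two distinct uncovered points
could be added to it as one more edge. *)
Lemma exists_almost_perfect_matching (X : Type) :
  exists2 R : set (X * X), matching R &
    forall x y, ~ (fst @` R `|` snd @` R) x -> ~ (fst @` R `|` snd @` R) y ->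
      x = y.
Proof.
have [|R [mR maxR]] := @Zorn_bigcup (X * X) matching.
  move=> F Fmatch Ftot p q [S FS Sp] [S' FS' S'q].
  have [SS'|S'S] := Ftot _ _ FS FS'.
    by apply: (Fmatch _ FS') => //; exact: SS'.
  by apply: (Fmatch _ FS) => //; exact: S'S.
exists R => // x y nx ny; apply: contrapT => xy.
have nR : ~ R (x, y) by move=> Rxy; apply: nx; left; exists (x, y).
apply: (maxR (R `|` [set (x, y)])).
  split; first by move=> p ?; left.
  by move=> /(_ (x, y)) h; apply: nR; apply: h; right.
have nx1 p : R p -> p.1 <> x by move=> Rp e; apply: nx; left; exists p.
have nx2 p : R p -> p.2 <> x by move=> Rp e; apply: nx; right; exists p.
have ny1 p : R p -> p.1 <> y by move=> Rp e; apply: ny; left; exists p.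
have ny2 p : R p -> p.2 <> y by move=> Rp e; apply: ny; right; exists p.
move=> p q [Rp|->] [Rq|->] /=; first exact: mR.
- by split=> [/(nx1 _ Rp)|/(ny2 _ Rp)|/(ny1 _ Rp)].
- by split=> [/esym/(nx1 _ Rq)|/esym/(ny2 _ Rq)|/esym/(nx2 _ Rq)].
- by split.
Qed.

(** Otherwise I would be closed under all images f[B].  Of the two sides of an
almost perfect matching, which are disjoint, one is in I, hence the other is,
being an image of it; the remaining point is the image of any nonempty member
of I, and the three sets cover X. *)
Lemma maximal_ideal_escape {X : Type} (hX : infinite_set [set: X])
  {I : set (set X)} (hI : maximal_ideal I) :
  exists (f : X -> X) (B : set X), I B /\ ~ I (f @` B).
Proof.
apply: contrapT => nesc.
have img (f : X -> X) B : I B -> I (f @` B).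
  by move=> IB; apply: contrapT => ?; apply: nesc; exists f, B.
have [[_ IS IU IT] _] := hI.
have [p [q [_ Ipq]]] := maximal_ideal_pair hX hI.
have I1 x : I [set x].
  by apply: IS (img (fun=> x) _ Ipq) => _ ->; exists p => //; left.
have [R mR Rcover] := exists_almost_perfect_matching X.
(* Images under functional relations: the matching is a partial function,
   extended here by the identity where it is undefined. *)
have img_rel (S : X -> X -> Prop) (B C : set X) : I B ->
    (forall b c c', S b c -> S b c' -> c = c') ->
    (forall c, C c -> exists2 b, B b & S b c) -> I C.
  move=> IB Sfun BC.
  have [f fP] : exists f : X -> X, forall b c, S b c -> f b = c.
    have [|f fP] := @choice X X (fun b c => forall c', S b c' -> c = c').
      move=> b; have [[c Sbc]|nc] := pselect (exists c, S b c).
        by exists c => c'; exact: Sfun.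
      by exists b => c' Sbc'; case: nc; exists c'.
    by exists f.
  by apply: IS (img f _ IB) => c /BC[b Bb /fP <-]; exists b.
have I12 : I (fst @` R) -> I (snd @` R).
  move=> IB; apply: (img_rel (fun a b => R (a, b)) _ _ IB).
    by move=> a b b' Rb Rb'; have [/(_ erefl)[]] := mR _ _ Rb Rb'.
  by move=> _ [[a b] Rab <-]; exists a => //; exists (a, b).
have I21 : I (snd @` R) -> I (fst @` R).
  move=> IB; apply: (img_rel (fun b a => R (a, b)) _ _ IB).
    by move=> b a a' Ra Ra'; have [_ /(_ erefl)[]] := mR _ _ Ra Ra'.
  by move=> _ [[a b] Rab <-]; exists b => //; exists (a, b).
have [I1R I2R] : I (fst @` R) /\ I (snd @` R).
  have [|/I12//|/[dup]/I21//] := maximal_ideal_prime hI (fst @` R) (snd @` R).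
  apply: IS (ideal0 hI.1) => _ [[r Rr <-] [s Rs]].
  by have [_ _ /[swap] ->] := mR _ _ Rr Rs.
have IM := IU _ _ I1R I2R.
have [x nx] : exists x, ~ (fst @` R `|` snd @` R) x.
  apply: contrapT => nx; apply: IT; apply: IS IM => x _.
  by apply: contrapT => ?; apply: nx; exists x.
apply: IT; apply: IS (IU _ _ IM (I1 x)) => y _.
by have [?|/(Rcover _ _ nx) <-] := pselect ((fst @` R `|` snd @` R) y);
  [left|right].
Qed.

Lemma ideal_clone_range {X : Type} {I : set (set X)} (hI : is_ideal I)
  (A : set X) (k : nat) (f : k.+1.-tuple X -> X) :
  I A -> range f `<=` A -> ideal_clone I (Op f).
Proof.
by move=> IA fA B _; apply: (idealS hI) IA => _ [x _ <-]; apply: fA; exists x.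
Qed.

Lemma ideal_clone_conservative {X : Type} {I : set (set X)} (hI : is_ideal I)
  (k : nat) (f : k.+1.-tuple X -> X) :
  (forall x, exists i, f x = tnth x i) -> ideal_clone I (Op f).
Proof.
move=> fc A; apply: (idealS hI) => _ [x Ax <-] /=.
by have [i ->] := fc x; exact: Ax.
Qed.

(** The components of a composition may send A^n into different members of I;
their finite union is the member of I to which the outer operation applies. *)
Lemma is_clone_ideal_clone {X : Type} {I : set (set X)} (hI : is_ideal I) :
  is_clone (ideal_clone I).
Proof.
split=> [n k|n k g f gI fI A IA].
  by apply: ideal_clone_conservative => // x; exists k.
pose B := \big[setU/set0]_(i < k.+1) (f i @` cartesian_power n.+1 A).
have IB : I B.
  by apply: big_ind => [|C D|i _]; [exact: ideal0|exact: idealU|exact: fI].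
apply: (idealS hI) (gI _ IB) => _ [x Ax <-].
exists [tuple f i x | i < k.+1] => // i; rewrite tnth_mktuple.
by rewrite /B (bigD1 i) //=; left; exists x.
Qed.

Lemma ideal_clone_reconstruct {X : Type} (hX : infinite_set [set: X])
  {I : set (set X)} (hI : maximal_ideal I) :
  I = [set A : set X | forall f : X -> X,
         range f `<=` A -> ideal_clone I (unop f)].
Proof.
have idI := hI.1.
apply/seteqP; split=> A /= hA.
  move=> f fA; apply: (ideal_clone_range idI A) => // _ [x _ <-].
  by apply: fA; exists (tnth x ord0).
apply: contrapT => nIA.
have [a Aa] := ideal_notin_nonempty idI _ nIA.
have [f [B [IB nIfB]]] := maximal_ideal_escape hX hI.
(* A retraction of X onto A. *)
pose r x := if pselect (A x) then x else a.
have rA : range (r \o f) `<=` A.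
  by move=> _ [x _ <-] /=; rewrite /r; case: pselect.
have IrfB := hA _ rA _ IB.
(* The image of B under r o f contains the trace of f[B] on A, and neither
   A nor f[B] is in I. *)
have [|//|//] := maximal_ideal_prime hI A (f @` B).
apply: (idealS idI) IrfB => y [Ay [b Bb fby]]; exists [tuple b].
  by move=> i; rewrite ord1.
by rewrite /= /r fby; case: pselect.
Qed.

(** Choosing preimages under f factors u as f o g with g into A^n, and each
component of g has its range in A. *)
Lemma clone_lift_range {X : Type} {I : set (set X)} (hI : is_ideal I)
  {D : set (op X)} (hD : is_clone D) (ID : ideal_clone I `<=` D)
  (n : nat) (f : n.+1.-tuple X -> X) (A : set X) (Df : D (Op f)) (IA : I A)
  (k : nat) (u : k.+1.-tuple X -> X) :
  range u `<=` f @` cartesian_power n.+1 A -> D (Op u).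
Proof.
move=> ufA.
have [|g gP] := @choice _ _ (fun x t => cartesian_power n.+1 A t /\ f t = u x).
  by move=> x; have [|t At ft] := ufA (u x); [exists x|exists t].
have -> : u = fun x => f [tuple tnth (g x) i | i < n.+1].
  apply/funext => x; rewrite -(gP x).2; congr f.
  by apply: eq_from_tnth => i; rewrite tnth_mktuple.
apply: (clone_comp hD (f := fun i x => tnth (g x) i)) => // i.
by apply/ID/(ideal_clone_range hI A) => // _ [x _ <-]; exact: (gP x).1.
Qed.

(** Gluing argument: any operation u agrees on the preimage of B = f[A^n] with
an operation into B, and elsewhere with one whose range is in I. *)
Lemma ideal_clone_coatom {X : Type} (hX : infinite_set [set: X])
  {I : set (set X)} (hI : maximal_ideal I)
  (D : set (op X)) (hD : is_clone D) (ID : ideal_clone I `<=` D)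
  (f : op X) (Df : D f) (nIf : ~ ideal_clone I f) : D = [set: op X].
Proof.
case: f Df nIf => n f Df nIf.
have idI := hI.1.
apply/seteqP; split=> // -[k u] _.
have [A [IA nIB]] : exists A, I A /\
    ~ I (f @` cartesian_power n.+1 A).
  apply: contrapT => nA; apply: nIf => A IA.
  by apply: contrapT => ?; apply: nA; exists A.
set B := (X in ~ I X) in nIB.
have IcB := maximal_idealC hI _ nIB.
have [b Bb] := ideal_notin_nonempty idI _ nIB.
have [p [q [pq Ipq]]] := maximal_ideal_pair hX hI.
pose inB x y z := if pselect (B (u x)) then y else z : X.
(* [parts 0] takes values in B, [parts 1] in the complement of B with p added,
   and [parts 2] is the test deciding which of the two [glue] returns. *)
pose parts (i : 'I_3) : k.+1.-tuple X -> X := fun x =>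
  match val i with
  | 0 => inB x (u x) b
  | 1 => inB x p (u x)
  | _ => inB x p q
  end.
pose glue (t : 3.-tuple X) :=
  if pselect (tnth t (inord 2) = p) then tnth t (inord 0) else tnth t (inord 1).
have -> : u = fun x => glue [tuple parts i x | i < 3].
  apply/funext => x; rewrite /glue !tnth_mktuple /parts /= !inordK // /inB.
  case: pselect => Bux; case: pselect => //.
  by move=> qp; case: pq.
apply: (clone_comp hD (g := glue) (f := parts)).
  apply/ID/(ideal_clone_conservative idI) => t.
  by rewrite /glue; case: pselect => ?; [exists (inord 0)|exists (inord 1)].
case=> -[|[|[|//]]] i3; rewrite /parts /=.
- apply: (clone_lift_range idI hD ID _ f A) => //.
  by move=> _ [x _ <-]; rewrite /inB; case: pselect.
- apply/ID/(ideal_clone_range idI (~` B `|` [set p; q])).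
    exact: (idealU idI).
  by move=> _ [x _ <-]; rewrite /inB; case: pselect => ?; [right; left|left].
- apply/ID/(ideal_clone_range idI [set p; q]) => //.
  by move=> _ [x _ <-]; rewrite /inB; case: pselect => ?; [left|right].
Qed.

Theorem fact2p2 (X : Type) (hX : infinite_set [set: X])
    (I : set (set X)) (hI : maximal_ideal I) :
  [/\ ideal_clone I `<` [set: op X],
      is_clone (ideal_clone I),
      (forall (k : nat) (f : k.+1.-tuple X -> X),
          I (range f) -> ideal_clone I (Op f)) /\
      (forall (A : set X) (k n : nat)
          (f : k.+1.-tuple X -> n.+1.-tuple X),
          I A -> range f `<=` cartesian_power n.+1 A ->
          clone_tilde (ideal_clone I) k n f),
      I = [set A : set X | forall f : X -> X,
             range f `<=` A -> ideal_clone I (unop f)] /\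
      (forall J J' : set (set X), maximal_ideal J -> maximal_ideal J' ->
          ideal_clone J = ideal_clone J' -> J = J')
    & precomplete (ideal_clone I) /\
      (forall f : op X, ~ ideal_clone I f ->
          clone_generated (ideal_clone I `|` [set f]) = [set: op X])].
Proof.
have idI := hI.1.
have cloneI := is_clone_ideal_clone idI.
have properI : ideal_clone I `<` [set: op X].
  split=> // TI; apply: (ideal_proper idI).
  by rewrite (ideal_clone_reconstruct hX hI) => f _; exact: TI.
split=> //; split.
- by move=> k f If; exact: (ideal_clone_range idI (range f)).
- move=> A k n f IA fA i; apply: (ideal_clone_range idI A) => // _ [x _ <-].
  by apply: fA; exists x.
- exact: ideal_clone_reconstruct.
- move=> J J' hJ hJ' JJ'.
  by rewrite (ideal_clone_reconstruct hX hJ) JJ' -ideal_clone_reconstruct.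
- split=> // D hD [ID nDI].
  have [f [Df nIf]] : exists f, D f /\ ~ ideal_clone I f.
    apply: contrapT => nf; apply: nDI => f Df.
    by apply: contrapT => ?; apply: nf; exists f.
  exact: (ideal_clone_coatom hX hI D hD ID f).
- move=> f nIf; apply/seteqP; split=> // g _ D [hD ID].
  rewrite (ideal_clone_coatom hX hI D hD _ f) //.
  + by move=> h Ih; apply: ID; left.
  + by apply: ID; right.
Qed.
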